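(* Let $X$ be a real normed linear space, let $K\subset X$ be a closed convex pointed cone with non-empty interior, and let $\varphi:X\to\mathbb{R}$. Then $\varphi$ is a gauge function for $K$ if and only if it satisfies the following three properties: (1) $\varphi$ is a continuous sublinear functional; (2) $\varphi(x)<0$ for every $x$ in the interior of $-K$; (3) $\varphi(x)>0$ for every $x\in X\setminus(-K)$.
   Context: $X^*$ denotes the topological dual of $X$ and $\langle x,x^*\rangle=x^*(x)$. A convex cone $K\subset X$ is a convex set containing $0$ and closed under multiplication by nonnegative scalars; it is pointed if $K\cap(-K)=\{0\}$. The positive polar cone of $K$ is $$K^+=\{x^*\in X^*\;|\;\langle x,x^*\rangle\geq 0\ \ \forall x\in K\}.$$ A gauge function for a closed convex pointed cone $K\subset X$ is a function of the form $$\varphi(x)=\sup_{x^*\in C}\langle x,x^*\rangle,\qquad x\in X,$$ where $C\subset K^+\setminus\{0\}$ is a weak-$*$ compact set which generates $K^+$ in the sense that $$K^+=\operatorname{cl}\,\operatorname{conv}\Big(\bigcup_{t\geq 0}tC\Big),$$ where $\operatorname{conv}$ is the convex hull and $\operatorname{cl}$ is the closure in the weak-$*$ topology of $X^*$. A sublinear functional is a real-valued function $\varphi$ on $X$ with $\varphi(x+y)\le\varphi(x)+\varphi(y)$ and $\varphi(tx)=t\varphi(x)$ for all $x,y\in X$, $t\geq 0$. *)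

(* Defs.v *)
From HB Require Import structures.
From mathcomp Require Import all_boot all_order all_algebra.
From mathcomp Require Import all_classical all_reals all_analysis.

Set Implicit Arguments.
Unset Strict Implicit.
Unset Printing Implicit Defensive.

Import Order.TTheory GRing.Theory Num.Theory.
Import numFieldNormedType.Exports.

Local Open Scope classical_set_scope.
Local Open Scope ring_scope.

Definition is_dual (R : realType) (X : normedModType R) : {pred X -> R^o} :=
  fun f => `[< linear f /\ continuous f >].
Arguments is_dual {R X} : simpl never.

Section dual_closed.
Context (R : realType) (X : normedModType R).

Let is_dual_submod : submod_closed (@is_dual R X).
Proof.
split=> [|a f g /asboolP[lf cf] /asboolP[lg cg]]; apply/asboolP; split.
- by move=> a x y /=; rewrite scaler0 addr0.
- by move=> x; exact: cvg_cst.
- move=> b x y; rewrite !fctE lf lg !scalerDr !scalerA mulrC -!addrA.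
  by congr (_ + _); rewrite addrCA.
- move=> x; apply: cvgD; last exact: cg.
  by apply: cvgZl_tmp; exact: cf.
Qed.

HB.instance Definition _ :=
  GRing.isSubmodClosed.Build R (X -> R^o) is_dual is_dual_submod.

End dual_closed.

(* The topological dual X^*, with its pointwise vector space structure. *)
Record dual (R : realType) (X : normedModType R) : Type :=
  Dual { dual_fun :> X -> R^o ; _ : dual_fun \in is_dual }.

Section dual_structures.
Context (R : realType) (X : normedModType R).

HB.instance Definition _ := [isSub for @dual_fun R X].
HB.instance Definition _ := [Choice of dual X by <:].
HB.instance Definition _ := [SubChoice_isSubLmodule of dual X by <:].

(* The weak-* topology: X^* is topologized by pointwise convergence on X,
   not by the operator norm. *)
HB.instance Definition _ := Topological.copy (dual X)
  (initial_topology (fun f : dual X => (f : X -> R^o) : {ptws X -> R^o})).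

End dual_structures.

Section gauge.
Context (R : realType) (X : normedModType R).
Implicit Types (K : set X) (phi : X -> R).

Definition convex_cone K : Prop :=
  [/\ convex_set K, K 0 & forall (t : R) x, 0 <= t -> K x -> K (t *: x)].

Definition pointed_cone K : Prop := K `&` [set - x | x in K] = [set 0].

Definition polar_cone K : set (dual X) :=
  [set f | forall x, K x -> 0 <= f x].

Definition convex_hull (E : lmodType R) (A : set E) : set E :=
  smallest (@convex_set R E) A.

Definition generates (C P : set (dual X)) : Prop :=
  P = closure (convex_hull
        (\bigcup_(t in [set t : R | 0 <= t]) [set t *: f | f in C])).

(* The supremum is taken in the extended reals, so that the equation also
   asserts that C is nonempty and that the supremum is finite. *)
Definition gauge_function K phi : Prop :=
  exists C : set (dual X),
    [/\ C `<=` polar_cone K `\` [set 0],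
        compact C,
        generates C (polar_cone K) &
        forall x, (phi x)%:E = ereal_sup [set (f x)%:E | f in C]].

Definition sublinear phi : Prop :=
  (forall x y, phi (x + y) <= phi x + phi y) /\
  (forall (t : R) x, 0 <= t -> phi (t *: x) = t * phi x).

End gauge.

(* Main.v *)
(* Every functional in [K^+] is bounded by a multiple of its value at an interior
   point of [K], so a weak-* compact [C] makes its supremum Lipschitz and, being
   attained, negative on the interior of [- K]; if the supremum were nonpositive
   at [x], so would be all of [K^+], and separation puts [x] in [- K].
   Conversely [phi] is the attained supremum of the set [C] of linear functionals
   below it (Hahn-Banach), which is weak-* compact. Any [f] in [K^+] is
   nonpositive where [phi] is, and this already forces [f <= t phi] for some
   [t >= 0]: the rays through [C] fill [K^+] without taking hull or closure. *)

Require Import Defs.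
From HB Require Import structures.
From mathcomp Require Import all_boot all_order all_algebra.
From mathcomp Require Import all_classical all_reals all_analysis.
From mathcomp Require Import lra.

Import Order.TTheory GRing.Theory Num.Theory.
Import numFieldNormedType.Exports.

Local Open Scope classical_set_scope.
Local Open Scope ring_scope.

(** * Sublinear functionals and the algebraic Hahn-Banach theorem *)

Section sublinear_theory.
Context {R : realType} {X : normedModType R}.
Implicit Types (p q : X -> R) (x y z : X).

Lemma sublinear0 p : sublinear p -> p 0 = 0.
Proof. by move=> [_ pZ]; rewrite -(scale0r 0) pZ// mul0r. Qed.

Lemma sublinear_geN p x : sublinear p -> - p (- x) <= p x.
Proof.
move=> sp; have := sp.1 x (- x); rewrite subrr sublinear0//.
by rewrite -lerBlDr sub0r.
Qed.

(* The three infima used below (a chain of sublinear functionals, a directional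
   derivative, the distance to a cone) are all instances of this one. *)
Lemma inf_sublinear (I : Type) (D : set I) (F : I -> X -> R) :
  D !=set0 ->
  (forall x, has_lbound [set F i x | i in D]) ->
  (forall i j x y, D i -> D j ->
     exists2 k, D k & F k (x + y) <= F i x + F j y) ->
  (forall i (t : R) x, D i -> 0 < t -> exists2 k, D k & F k (t *: x) <= t * F i x) ->
  sublinear (fun x => inf [set F i x | i in D]).
Proof.
move=> [i0 Di0] lbF FD FZ; pose m x := inf [set F i x | i in D].
have m_le i x : D i -> m x <= F i x by move=> Di; apply: ge_inf; [|exists i].
have le_m a x : (forall i, D i -> a <= F i x) -> a <= m x.
  move=> aF; apply: lb_le_inf; first by exists (F i0 x), i0.
  by move=> _ [i Di <-]; exact: aF.
have mZle t x : 0 < t -> m (t *: x) <= t * m x.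
  move=> t0; rewrite -ler_pdivrMl//; apply: (le_m) => i Di.
  rewrite ler_pdivrMl//; have [k Dk] := FZ i t x Di t0.
  exact/le_trans/m_le.
have mZ t x : 0 < t -> m (t *: x) = t * m x.
  move=> t0; apply/eqP; rewrite eq_le mZle//= -ler_pdivlMl//.
  have := mZle t^-1 (t *: x); rewrite scalerA mulVf ?gt_eqF// scale1r.
  by apply; rewrite invr_gt0.
have m0 : m 0 = 0.
  by have := mZ 2 0 ltac:(by []); rewrite scaler0; lra.
split=> [x y|t x]; last first.
  rewrite le_eqVlt => /predU1P[<-|t0]; last exact: mZ.
  by rewrite scale0r mul0r; exact: m0.
change (m (x + y) <= m x + m y); rewrite -lerBlDr; apply: (le_m) => i Di.
rewrite lerBlDr -lerBlDl; apply: le_m => j Dj; rewrite lerBlDl.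
have [k Dk Fk] := FD i j x y Di Dj.
exact: le_trans (m_le k _ Dk) Fk.
Qed.

(** [q] is the directional derivative of [p] at [x], written as the infimum over [t >= 0] of
    [p (y + t *: x) - t * p x]; [t = 0] and [t = 1] give the two bounds. *)
Lemma sublinear_directional p x : sublinear p -> exists q, [/\ sublinear q,
  forall y, q y <= p y & forall y, q y <= p (y + x) - p x].
Proof.
move=> sp; have [pD pZ] := sp.
pose F (t : R) y := p (y + t *: x) - t * p x.
pose D := [set t : R | 0 <= t].
have lbF y : has_lbound [set F t y | t in D].
  exists (- p (- y)) => _ [t /= t0 <-]; rewrite /F.
  have := pD (y + t *: x) (- y); rewrite addrAC subrr add0r pZ//; lra.
exists (fun y => inf [set F t y | t in D]); split=> [|y|y].
- apply: inf_sublinear => //; first by exists 0; exact: lexx.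
  + move=> s t y z /= s0 t0; exists (s + t); first exact: addr_ge0.
    have := pD (y + s *: x) (z + t *: x).
    by rewrite /F scalerDl addrACA; lra.
  + move=> s t y /= s0 t0; exists (t * s); first by rewrite /D/= mulr_ge0// ltW.
    by rewrite /F -scalerA -scalerDr pZ ?(ltW t0)//; lra.
- apply: le_trans (ge_inf (lbF y) _) _; first by exists 0; [exact: lexx|].
  by rewrite /F scale0r mul0r addr0 subr0.
- apply: le_trans (ge_inf (lbF y) _) _; first by exists 1; [exact: ler01|].
  by rewrite /F scale1r mul1r.
Qed.

(** Provides the bounds of chains for Zorn's lemma. Comparability makes the infimum subadditive: the
    smaller of two members serves both summands. *)
Lemma sublinear_chain_inf p (I : Type) (D : set I) (q : I -> X -> R) :
  D !=set0 ->
  (forall i, D i -> sublinear (q i) /\ forall x, q i x <= p x) ->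
  (forall i j, D i -> D j ->
     (forall x, q i x <= q j x) \/ (forall x, q j x <= q i x)) ->
  exists r, [/\ sublinear r, forall x, r x <= p x &
    forall i x, D i -> r x <= q i x].
Proof.
move=> D0 qp tot; have [i0 Di0] := D0.
have lbq x : has_lbound [set q i x | i in D].
  exists (- p (- x)) => _ [i Di <-]; have [sq qle] := qp i Di.
  by have := sublinear_geN _ x sq; have := qle (- x); lra.
have ltq i x : D i -> inf [set q i x | i in D] <= q i x.
  by move=> Di; apply: ge_inf; [|exists i].
exists (fun x => inf [set q i x | i in D]); split=> [|x|//].
- apply: inf_sublinear => //.
  + move=> i j x y Di Dj.
    have [[qiD _] _] := qp i Di; have [[qjD _] _] := qp j Dj.
    case: (tot i j Di Dj) => [ij|ji]; [exists i|exists j] => //.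
    * by rewrite (le_trans (qiD x y))// lerD2l.
    * by rewrite (le_trans (qjD x y))// lerD2r.
  + move=> i t x Di t0; exists i => //.
    by have [[_ qZ] _] := qp i Di; rewrite qZ// ltW.
- by apply: le_trans (ltq i0 x Di0) _; have [_] := qp i0 Di0; exact.
Qed.

(* A minimal sublinear functional coincides with all of its directional
   derivatives, which forces it to be additive. *)
Lemma sublinear_minimal_linear q : sublinear q ->
  (forall r, sublinear r -> (forall x, r x <= q x) -> r = q) ->
  linear (q : X -> R^o).
Proof.
move=> sq qmin; have [qD qZ] := sq.
have qDE x y : q (x + y) = q x + q y.
  apply/eqP; rewrite eq_le qD/=.
  have [r [sr rq rx]] := sublinear_directional _ y sq.
  by have := rx x; rewrite (qmin r sr rq); lra.
have qN x : q (- x) = - q x.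
  by have := qDE x (- x); rewrite subrr sublinear0//; lra.
move=> t x y; rewrite qDE; congr (_ + _).
have [t0|t0] := leP 0 t; first exact: qZ.
rewrite -[t *: x]opprK qN -scaleNr qZ ?oppr_ge0 ?(ltW t0)//.
by rewrite mulNr opprK.
Qed.

(** Zorn's lemma is applied below the directional derivative of [p] at [x0] rather than below [p]:
    its value at [- x0] is at most [- p x0], which forces equality at [x0]. *)
Lemma hahn_banach p x0 : sublinear p -> exists f : X -> R^o,
  [/\ linear f, forall x, f x <= p x & f x0 = p x0].
Proof.
move=> sp; have [p' [sp' p'p p'x0]] := sublinear_directional _ x0 sp.
pose T := {q : X -> R | sublinear q /\ forall x, q x <= p' x}.
(* The order is reversed, so that a maximal element is a minimal sublinear functional. *)
pose r (a b : T) := `[< forall x, sval b x <= sval a x >].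
have [||||q qmin] := @Zorn T r.
- by move=> a; apply/asboolP.
- move=> a b c /asboolP ab /asboolP bc; apply/asboolP => x.
  exact: le_trans (bc x) (ab x).
- move=> [a Ha] [b Hb] /asboolP/= ab /asboolP/= ba; apply: eq_exist.
  by apply/funext => x; apply/eqP; rewrite eq_le ab ba.
- move=> A Atot; have [A0|/set0P A0] := eqVneq A set0.
    by exists (exist _ p' (conj sp' (fun=> lexx _))) => s; rewrite A0.
  have [|i j Ai Aj|q [sq qp qle]] :=
      @sublinear_chain_inf p' T A (fun a => sval a) A0.
  + by move=> [a Ha] _ /=; exact: Ha.
  + by have [/asboolP|/asboolP] := Atot _ _ Ai Aj; [right|left].
  + exists (exist _ q (conj sq qp)) => s As; apply/asboolP => x /=.
    exact: qle.
case: q qmin => q [sq qp'] qmin.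
exists q; split=> [|x|].
- apply: sublinear_minimal_linear => // s ss sq'.
  have H : sublinear s /\ forall x, s x <= p' x.
    by split=> // x; exact: le_trans (sq' x) (qp' x).
  by have /(congr1 sval) := qmin (exist _ s H) ltac:(exact/asboolP).
- exact: le_trans (qp' x) (p'p x).
- apply/eqP; rewrite eq_le (le_trans (qp' x0)) ?p'p//=.
  have := p'x0 (- x0); rewrite addNr sublinear0// => p'N.
  by have := sublinear_geN _ x0 sq; have := qp' (- x0); lra.
Qed.

End sublinear_theory.

(** * The dual space and its weak-* topology *)

Section dual_theory.
Context {R : realType} {X : normedModType R}.
Implicit Types (p q : X -> R) (x y : X) (f g : dual X) (K : set X).

Lemma dual_linear f : linear f.
Proof. by case: f => f /= /asboolP[]. Qed.

HB.instance Definition _ f :=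
  GRing.isLinear.Build R X R^o _ (f : X -> R^o) (dual_linear f).

Lemma dualZr f (t : R) x : f (t *: x) = t * f x.
Proof. by rewrite linearZ. Qed.

Lemma dualD f x y : f (x + y) = f x + f y.
Proof. exact: linearD. Qed.

Lemma dualN f x : f (- x) = - f x.
Proof. exact: linearN. Qed.

Lemma dual_le0 f : (forall x, f x <= 0) -> f = 0.
Proof.
move=> fle; apply/val_inj/funext => x /=; apply/eqP; rewrite eq_le fle/=.
by have := fle (- x); rewrite dualN oppr_le0.
Qed.

Lemma dual_scaleE (t : R) f x : (t *: f) x = t * f x.
Proof. by []. Qed.

Lemma dual_eval_continuous x : continuous (fun f => f x : R^o).
Proof.
move=> f.
apply: (@continuous_comp _ {ptws X -> R^o} _ _ (fun h : {ptws X -> R^o} => h x)).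
  exact: initial_continuous.
exact: proj_continuous.
Qed.

Lemma linear_sublinear (h : X -> R^o) : linear h -> sublinear h.
Proof.
move=> lh; split=> [x y|t x _].
  by have := lh 1 x y; rewrite !scale1r => ->.
have h0 : h 0 = 0 by have := lh (- 1) 0 0; rewrite scaler0 addr0 scaleN1r addNr.
by have := lh t x 0; rewrite h0 !addr0.
Qed.

(** Subadditivity squeezes [q y] between [q x - p (x - y)] and [q x + p (y - x)], and both
    correction terms tend to [p 0]. *)
Lemma sublinear_continuous p q : sublinear q -> (forall x, q x <= p x) ->
  continuous p -> p 0 = 0 -> continuous q.
Proof.
move=> [qD _] qp pC p0 x.
have cv (s : R) : (fun y : X => p (s *: (y - x))) y @[y --> x] --> (0 : R).
  have -> : 0 = p (s *: (x - x)) by rewrite subrr scaler0.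
  apply: (@continuous_comp _ _ _ (fun y => s *: (y - x)) p); last exact: pC.
  by apply: cvgZl_tmp; apply: cvgB; [exact: cvg_id|exact: cvg_cst].
apply: (@squeeze_cvgr _ _ _ _ (fun y => q x - p (-1 *: (y - x))) (fun y => q x + p (1 *: (y - x)))).
- apply: nearW => y; rewrite scaleN1r opprB scale1r.
  have := qD (x - y) y; have := qD (y - x) x; rewrite !subrK.
  by have := qp (x - y); have := qp (y - x); lra.
- by rewrite -[X in _ --> X]subr0; apply: cvgB; [exact: cvg_cst|exact: cv].
- by rewrite -[X in _ --> X]addr0; apply: cvgD; [exact: cvg_cst|exact: cv].
Qed.

Lemma dominated_dual p (h : X -> R^o) : continuous p -> sublinear p ->
  linear h -> (forall x, h x <= p x) -> exists f, (f : X -> R^o) = h.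
Proof.
move=> cp sp lh hp.
have hd : h \in is_dual.
  apply/asboolP; split=> //; apply: sublinear_continuous hp cp _.
    exact: linear_sublinear.
  exact: sublinear0.
by exists (Dual hd).
Qed.

(* Banach-Alaoglu, with [p] in place of the norm. *)
Lemma compact_dual_le p : continuous p -> sublinear p ->
  compact [set f : dual X | forall x, f x <= p x].
Proof.
move=> cp sp F FF FC.
(* Domination at [x] and at [- x] confines each value to a segment, so Tychonoff's theorem
   applies. *)
pose box := [set h : {ptws X -> R^o} | forall x, `[- p (- x), p x]%classic (h x)].
have cbox : compact box.
  exact: (@tychonoff X (fun=> R^o) (fun x => `[- p (- x), p x]%classic)
    (fun x => @segment_compact R (- p (- x)) (p x))).
have ev z : continuous (fun h : {ptws X -> R^o} => h z : R^o).
  exact: (@proj_continuous X (fun=> R^o) z).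
(* The linear functions are the common zeros of these continuous maps, hence closed under pointwise
   convergence. *)
pose defect (a : R * X * X) (h : {ptws X -> R^o}) : R^o :=
  h (a.1.1 *: a.1.2 + a.2) - (a.1.1 *: (h a.1.2 : R^o) + h a.2).
pose lin := \bigcap_(a in setT) (defect a @^-1` [set 0]).
have clin : closed lin.
  apply: closed_bigI => a _; apply: preimage_closed; last exact: closed_eq.
  move=> h _; exact: (cvgB (ev _ h) (cvgD (cvgZl_tmp (ev _ h)) (ev _ h))).
pose G : set_system {ptws X -> R^o} :=
  (fun f : dual X => (f : {ptws X -> R^o})) @ F.
have PG : ProperFilter G by exact: fmap_proper_filter.
have GC : G (box `&` lin).
  suff sub : [set f : dual X | forall x, f x <= p x] `<=`
      (fun f : dual X => (f : {ptws X -> R^o})) @^-1` (box `&` lin).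
    exact: filterS sub FC.
  move=> f /= fp; split=> [x|[[t x] y] _].
    rewrite /= in_itv/=; apply/andP; split; last exact: fp.
    by rewrite lerNl; have := fp (- x); rewrite linearN.
  by rewrite /= /defect/= linearP subrr.
have [h [[hbox hlin] hG]] := compact_closedI cbox clin PG GC.
have lh : linear (h : X -> R^o).
  by move=> t x y; apply/eqP; rewrite -subr_eq0; apply/eqP; exact: (hlin (t, x, y)).
have hp x : h x <= p x by have := hbox x; rewrite /= in_itv/= => /andP[].
have [f fh] := dominated_dual _ _ cp sp lh hp.
(* Weak-* neighbourhoods are traces of pointwise ones, so clustering of the image filter [G] at [h]
   pulls back to clustering of [F] at [f]. *)
exists f; split=> [x|A B FA [_ [[U oU <-] Uf UB]]]; first by rewrite fh hp.
have GA : G [set (g : {ptws X -> R^o}) | g in A].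
  suff sub : A `<=` (fun g : dual X => (g : {ptws X -> R^o})) @^-1`
      [set (g : {ptws X -> R^o}) | g in A] by exact: filterS sub FA.
  by move=> g Ag; exists g.
have hU : nbhs h U by rewrite -fh; exact: open_nbhs_nbhs.
have [_ [[g Ag <-] Ug]] := hG _ _ GA hU.
by exists g; split=> //; exact: UB.
Qed.

(** * Cones: interior points, polar functionals and separation *)

Lemma interior_polar_bound K x : interior K x ->
  exists2 c : R, 0 < c & forall f, polar_cone K f ->
    forall y, f y <= c * `|y| * f x.
Proof.
move=> /nbhs_closedballP[r rK]; exists r%:num^-1 => // f fK y.
have [->|y0] := eqVneq y 0; first by rewrite normr0 mulr0 mul0r linear0.
have ny : 0 < `|y| by rewrite normr_gt0.
(* A step of length [r] from [x] against [y] stays in [K]; nonnegativity of [f] there is the bound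
   with [c = 1 / r]. *)
have Kxy : K (x - (r%:num / `|y|) *: y).
  apply: rK; rewrite closed_ballE// /closed_ball_/= opprB addrC subrK.
  by rewrite normrZ ger0_norm ?divr_ge0// divfK ?gt_eqF.
have := fK _ Kxy; rewrite linearB/= dualZr subr_ge0 => /(ler_wpM2l (ltW ny)).
rewrite mulrA [X in X * f y]mulrCA divff ?gt_eqF// mulr1.
by rewrite -mulrA ler_pdivlMl.
Qed.

Lemma interior_polar_gt0 K x f : interior K x ->
  polar_cone K f -> f != 0 -> 0 < f x.
Proof.
move=> /interior_polar_bound[c c0 fb] fK f0.
rewrite ltNge; apply: contraNN f0 => fx.
apply/eqP/dual_le0 => y; apply: le_trans (fb _ fK y) _.
by rewrite mulr_ge0_le0// mulr_ge0// ltW.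
Qed.

Lemma interiorN K x : interior [set - y | y in K] x <-> interior K (- x).
Proof.
split=> xK.
  have {}xK : nbhs (- - x) [set - y | y in K] by rewrite opprK.
  have sub : (-%R) @^-1` [set - y | y in K] `<=` K.
    by move=> y [z Kz /oppr_inj <-].
  exact: filterS sub (@opp_continuous _ (- x) _ xK).
have sub : (-%R) @^-1` K `<=` [set - y | y in K].
  by move=> y Ky; exists (- y); rewrite ?opprK.
exact: filterS sub (@opp_continuous _ x _ xK).
Qed.

Lemma convex_coneD K x y : convex_cone K -> K x -> K y -> K (x + y).
Proof.
move=> [cvK _ KZ] Kx Ky.
have h0 : 0 <= (2^-1 : R) by lra.
have h1 : (2^-1 : R) <= 1 by lra.
(* The sum is the midpoint of [2 *: x] and [2 *: y]. *)
have := cvK (2 *: x) (2 *: y) (Itv01 h0 h1); rewrite !inE.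
move=> /(_ (KZ 2 x (ler0n _ 2) Kx) (KZ 2 y (ler0n _ 2) Ky)).
change (K (2^-1 *: (2 *: x) + (1 - 2^-1) *: (2 *: y)) -> K (x + y)).
rewrite !scalerA.
have -> : (1 - 2^-1) * 2 = 1 :> R by lra.
by rewrite mulVf ?scale1r// pnatr_eq0.
Qed.

(** The translate of [K] by [x] is a neighbourhood of [x + y] contained in [K]. *)
Lemma interior_coneD K x y : convex_cone K -> K x -> interior K y ->
  interior K (x + y).
Proof.
move=> coneK Kx Ky.
have sub : (fun z => z - x) @^-1` K `<=` K.
  by move=> z Kzx; rewrite -(subrK x z); exact: convex_coneD.
have cB : continuous (fun z : X => z - x).
  by move=> z; apply: cvgB; [exact: cvg_id|exact: cvg_cst].
have {}Ky : nbhs (x + y - x) K by rewrite addrAC subrr add0r.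
exact: filterS sub (cB _ _ Ky).
Qed.

(* The functional is dominated by the distance to [- K], which is sublinear. *)
Lemma separate_cone K x : closed K -> convex_cone K -> ~ K x ->
  exists2 f, polar_cone K f & f x < 0.
Proof.
move=> clK coneK Kx; have [_ K0 KZ] := coneK.
have KD y z : K y -> K z -> K (y + z) by apply: convex_coneD.
pose d y := inf [set `|y + k| | k in K].
have lbd y : has_lbound [set `|y + k| | k in K] by exists 0 => _ [k _ <-].
have sd : sublinear d.
  apply: inf_sublinear => //; first by exists 0.
  - move=> k l y z Kk Kl; exists (k + l); first exact: KD.
    by rewrite addrACA ler_normD.
  - move=> k t y Kk t0; exists (t *: k); first exact: KZ (ltW t0) _.
    by rewrite -scalerDr normrZ gtr0_norm.
have d_le k y : K k -> d y <= `|y + k|.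
  by move=> Kk; apply: ge_inf => //; exists k.
have dnorm y : d y <= `|y| by rewrite -[y in `|y|]addr0; exact: d_le.
have dNx : 0 < d (- x).
  (* A ball around [x] misses the closed set [K]; its radius bounds the distance from [- x] to [- K]
     from below. *)
  have /nbhs_ballP[r r0 rK] : nbhs x (~` K).
    by apply: open_nbhs_nbhs; split=> //; exact: closed_openC.
  apply: lt_le_trans r0 _; apply: lb_le_inf; first by exists `|- x + 0|, 0.
  move=> _ [k Kk <-]; rewrite leNgt; apply/negP => kr; apply: (rK k) => //.
  by rewrite -ball_normE /ball_/= distrC addrC.
have [h [lh hd hx]] := hahn_banach d (- x) sd.
have [f fh] : exists f, (f : X -> R^o) = h.
  apply: dominated_dual lh (fun y => le_trans (hd y) (dnorm y)).
    exact: norm_continuous.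
  by split=> [y z|t y t0]; [exact: ler_normD|rewrite normrZ ger0_norm].
exists f; last by rewrite -oppr_gt0 -dualN fh hx.
move=> k Kk; rewrite -oppr_le0 -dualN fh (le_trans (hd _))//.
by apply: le_trans (d_le k _ Kk) _; rewrite addNr normr0.
Qed.

(** The half-space of functionals nonnegative at [x] is convex and weak-* closed, so it absorbs the
    hull and the closure once it contains the rays. *)
Lemma closure_cone_hull_ge0 (C : set (dual X)) x :
  (forall f, C f -> 0 <= f x) ->
  forall f, closure (convex_hull
        (\bigcup_(t in [set t : R | 0 <= t]) [set t *: f | f in C])) f ->
  0 <= f x.
Proof.
move=> Cx; pose H := (fun f => f x : R^o) @^-1` [set a | 0 <= a].
have cH : closed H.
  apply: preimage_closed; last exact: closed_ge.
  by move=> f _; exact: dual_eval_continuous.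
move=> f; rewrite closureE => /(_ H); apply; split=> //.
apply: smallest_sub => [g h a|_ [t t0 [g Cg <-]]]; last first.
  by change (0 <= t * g x); rewrite mulr_ge0// Cx.
rewrite !inE /H/= => gx hx.
change (0 <= a%:num * g x + (1 - a%:num) * h x).
by rewrite addr_ge0// mulr_ge0// subr_ge0.
Qed.

End dual_theory.

(** * Gauge functions have the three properties *)

Section gauge_theory.
Context {R : realType} {X : normedModType R}.
Implicit Types (phi : X -> R) (K : set X) (C : set (dual X)).

(** Evaluation at [x] is weak-* continuous, so the extreme value theorem applies; [C] is nonempty
    because an empty supremum would be [-oo], not a real number. *)
Lemma compact_sup_attained C phi : compact C ->
  (forall x, (phi x)%:E = ereal_sup [set (f x)%:E | f in C]) ->
  forall x, (forall f, C f -> f x <= phi x) /\ exists2 f, C f & f x = phi x.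
Proof.
move=> cC phiE x.
have fle f : C f -> f x <= phi x.
  by move=> Cf; rewrite -lee_fin phiE; apply: ereal_sup_ubound; exists f.
split=> //; have C0 : C !=set0.
  apply/set0P/eqP => C0; have := phiE x.
  by rewrite C0 image_set0 ereal_sup0.
have [|f /set_mem Cf fmax] := @compact_EVT_max _ R (fun f : dual X => f x) C C0 cC.
  by apply: continuous_subspaceT; exact: dual_eval_continuous.
exists f => //; apply/eqP; rewrite eq_le fle//= -lee_fin phiE.
by apply: ge_ereal_sup => _ [g Cg <-]; rewrite lee_fin; apply/fmax/mem_set.
Qed.

Lemma gauge_function_sublinear K phi : interior K !=set0 ->
  gauge_function K phi -> continuous phi /\ sublinear phi.
Proof.
move=> [e Ke] [C [CK cC _ /(compact_sup_attained _ _ cC) phiC]].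
have fle f x : C f -> f x <= phi x by have [+ _] := phiC x; exact.
have sphi : sublinear phi.
  split=> [x y|t x t0].
    have [_ [f Cf <-]] := phiC (x + y).
    by rewrite dualD lerD ?fle.
  apply/eqP; rewrite eq_le; apply/andP; split.
    by have [_ [f Cf <-]] := phiC (t *: x); rewrite dualZr ler_wpM2l ?fle.
  by have [_ [f Cf <-]] := phiC x; rewrite -dualZr fle.
(* A functional [f] of [C] attaining [phi y] satisfies [f y <= c * |y| * f e <= c * |y| * phi e], a
   continuous bound vanishing at [0]. *)
split=> //; have [c c0 cb] := interior_polar_bound _ _ Ke.
apply: (@sublinear_continuous _ _ (fun y => c * `|y| * phi e)) => //.
- move=> y; have [_ [f Cf <-]] := phiC y.
  have [fK _] := CK _ Cf.
  rewrite (le_trans (cb f fK y))// ler_wpM2l ?fle//.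
  by rewrite mulr_ge0// ltW.
- move=> y; apply: cvgM; last exact: cvg_cst.
  by apply: cvgM; [exact: cvg_cst|exact: norm_continuous].
- by rewrite normr0 mulr0 mul0r.
Qed.

Lemma gauge_function_lt0 K phi x : gauge_function K phi ->
  interior [set - y | y in K] x -> phi x < 0.
Proof.
move=> [C [CK cC _ /(compact_sup_attained _ _ cC)/(_ x)[_ [f Cf <-]]]].
move=> /interiorN Kx; have [fK /eqP f0] := CK _ Cf.
by rewrite -oppr_gt0 -dualN (interior_polar_gt0 _ _ _ Kx).
Qed.

Lemma gauge_function_gt0 K phi x : closed K -> convex_cone K ->
  gauge_function K phi -> ~ [set - y | y in K] x -> 0 < phi x.
Proof.
move=> clK coneK [C [CK cC genC /(compact_sup_attained _ _ cC)/(_ x)[fle _]]] Kx.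
have [|g gK gx] := separate_cone K (- x) clK coneK.
  by move=> KNx; apply: Kx; exists (- x); rewrite ?opprK.
rewrite ltNge; apply/negP => phix; move: gK; rewrite genC.
move=> gC; suff : 0 <= g (- x) by rewrite leNgt gx.
apply: closure_cone_hull_ge0 gC => f Cf.
by rewrite dualN oppr_ge0; exact: le_trans (fle f Cf) phix.
Qed.

(** * The three properties yield a gauge function *)

Lemma sublinear_le0_opp_cone K phi : convex_cone K -> interior K !=set0 ->
  sublinear phi ->
  (forall x, interior [set - y | y in K] x -> phi x < 0) ->
  forall x, K x -> phi (- x) <= 0.
Proof.
move=> coneK [e Ke] [phiD phiZ] phi_lt0 x Kx.
(* Subtracting [e] moves [- (t *: x)] into the interior of [- K] at a cost of [phi e], independent
   of [t]; a positive [phi (- x)] would violate this for large [t]. *)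
have phiNe t : 0 < t -> t * phi (- x) < phi e.
  move=> t0; have Ktx : K (t *: x) by case: coneK => _ _; apply=> //; exact: ltW.
  have : phi (- (t *: x + e)) < 0.
    by apply/phi_lt0/interiorN; rewrite opprK; exact: interior_coneD.
  have := phiD (- (t *: x + e)) e.
  rewrite opprD addrNK -scalerN phiZ ?(ltW t0)//; lra.
rewrite leNgt; apply/negP => px.
have pe : 0 < phi e.
  by apply: le_lt_trans (phiNe 1 ltr01); rewrite mul1r ltW.
by have := phiNe (phi e / phi (- x)); rewrite divr_gt0// divfK ?gt_eqF// ltxx => /(_ isT).
Qed.

(* A functional nonpositive where [phi] is nonpositive is squeezed: if
   [phi y = 1] and [phi z = -1] then [phi (y + z) <= 0], so [f y <= - f z];
   hence [t] can be chosen as the supremum of the ratios [f y / phi y]. *)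
Lemma sublinear_multiplier phi (f : dual X) e : sublinear phi -> phi e < 0 ->
  (forall x, phi x <= 0 -> f x <= 0) ->
  exists2 t : R, 0 <= t & forall x, f x <= t * phi x.
Proof.
move=> sphi phie fle; have [phiD phiZ] := sphi.
have cross y z : 0 < phi y -> phi z < 0 -> f y / phi y <= f z / phi z.
  move=> y0 z0; have zy : 0 < - phi z by rewrite oppr_gt0.
  (* The positive weights reduce to the normalised case: after subadditivity the two contributions
     to [phi] cancel. *)
  have := fle ((- phi z) *: y + phi y *: z).
  rewrite dualD !dualZr => H.
  have {}H : - phi z * f y + phi y * f z <= 0.
    apply: H; apply: le_trans (phiD _ _) _.
    by rewrite !phiZ ?(ltW zy, ltW y0)// mulNr mulrC addNr.
  rewrite ler_pdivrMr// mulrAC ler_ndivlMr//; lra.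
pose S := [set f y / phi y | y in [set y | 0 < phi y]].
have ubS z : phi z < 0 -> ubound S (f z / phi z).
  by move=> z0 _ [y y0 <-]; exact: cross.
(* The ratio at [- e] shows that [S] is nonempty and that its supremum is nonnegative, as
   [f e <= 0]. *)
have phiNe : 0 < phi (- e) by have := sublinear_geN _ e sphi; lra.
have SNe : S (f (- e) / phi (- e)) by exists (- e).
have hubS : has_ubound S by exists (f e / phi e); exact: ubS.
exists (sup S) => [|x].
  apply: le_trans (ub_le_sup hubS SNe).
  by rewrite dualN divr_ge0 ?(ltW phiNe)// oppr_ge0 fle// ltW.
have [x0|x0|x0] := ltgtP (phi x) 0.
- rewrite -ler_ndivlMr//; apply: ge_sup; last exact: ubS.
  by exists (f (- e) / phi (- e)).
- by rewrite -ler_pdivrMr//; apply: ub_le_sup => //; exists x.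
- by rewrite x0 mulr0 fle// x0.
Qed.

Lemma closure_hull_sub_polar K C : C `<=` polar_cone K ->
  closure (convex_hull
    (\bigcup_(t in [set t : R | 0 <= t]) [set t *: f | f in C]))
  `<=` polar_cone K.
Proof.
move=> CK f fC x Kx; apply: closure_cone_hull_ge0 fC => g Cg.
exact: CK.
Qed.

Lemma sublinear_gauge_function K phi :
  convex_cone K -> interior K !=set0 -> continuous phi -> sublinear phi ->
  (forall x, interior [set - y | y in K] x -> phi x < 0) ->
  (forall x, ~ [set - y | y in K] x -> 0 < phi x) -> gauge_function K phi.
Proof.
move=> coneK K0 cphi sphi phi_lt0 phi_gt0.
have phiK := sublinear_le0_opp_cone K phi coneK K0 sphi phi_lt0.
have [e e0] : exists e, phi e < 0.
  by have [e Ke] := K0; exists (- e); apply/phi_lt0/interiorN; rewrite opprK.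
pose C := [set f : dual X | forall x, f x <= phi x].
have phiC x : exists2 f, C f & f x = phi x.
  have [h [lh hp hx]] := hahn_banach phi x sphi.
  have [f fh] := dominated_dual phi h cphi sphi lh hp.
  by exists f; rewrite /C/= fh.
have CK : C `<=` polar_cone K.
  move=> f Cf x Kx; rewrite -oppr_le0 -dualN.
  exact: le_trans (Cf _) (phiK x Kx).
exists C; split.
- move=> f Cf; split; first exact: CK.
  by move=> /= f0; have := Cf e; rewrite f0 leNgt e0.
- exact: compact_dual_le.
- apply/seteqP; split; last exact: closure_hull_sub_polar.
  move=> f fK; apply: subset_closure; apply: sub_gen_smallest.
  have [|t t0 ft] := sublinear_multiplier phi f e sphi e0.
    move=> x phix; have [[y Ky <-]|/phi_gt0] := pselect ([set - y | y in K] x).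
      by rewrite dualN oppr_le0; exact: fK.
    by rewrite ltNge phix.
  (* If [t = 0] then [f] is nonpositive everywhere, hence zero, and lies on the ray of any member of
     [C]; otherwise [t^-1 *: f] is in [C]. *)
  have [t_eq0|tn0] := eqVneq t 0.
    have [g Cg _] := phiC 0; exists 0; first exact: lexx.
    exists g => //; rewrite scale0r; apply/esym/dual_le0 => x.
    by have := ft x; rewrite t_eq0 mul0r.
  exists t => //; exists (t^-1 *: f); last by rewrite scalerA divff// scale1r.
  move=> x; rewrite dual_scaleE ler_pdivrMl// lt_neqAle eq_sym tn0.
  exact: t0.
- move=> x; apply/eqP; rewrite eq_le; apply/andP; split.
    by have [f Cf <-] := phiC x; apply: ereal_sup_ubound; exists f.
  by apply: ge_ereal_sup => _ [f Cf <-]; rewrite lee_fin.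
Qed.

End gauge_theory.

Theorem theorem3 (R : realType) (X : normedModType R) (K : set X)
    (phi : X -> R) :
  closed K -> convex_cone K -> pointed_cone K -> interior K !=set0 ->
  gauge_function K phi <->
  [/\ continuous phi /\ sublinear phi,
      forall x : X, interior [set - y | y in K] x -> phi x < 0 &
      forall x : X, ~ [set - y | y in K] x -> 0 < phi x].
Proof.
move=> clK coneK _ K0; split=> [gphi|[[cphi sphi] phi_lt0 phi_gt0]].
  split; first exact: gauge_function_sublinear gphi.
  - by move=> x; exact: gauge_function_lt0.
  - by move=> x; exact: gauge_function_gt0.
exact: sublinear_gauge_function.
Qed.
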